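(* Let $(f_{n,q})_{n\ge0}$ be the $q$-Fubini numbers. Then $f_{0,q}=1$ and, for every $n\ge1$, $$f_{n,q}=\sum_{k=1}^n\ \sum_{\rho\in\mathfrak P_n^k}\ \prod_{i=0}^{k-1}{s_{k-i}\brack b_{k-i}}_q,$$ where, for $\rho=(B_1,\dots,B_k)\in\mathfrak P_n^k$, $b_i=|B_i|$ and $s_i=\sum_{j=1}^i b_j$.
   Context: Let $q\in\mathbb C$ be nonzero and not a root of unity. Put $[n]_q=\frac{1-q^n}{1-q}$, $[n]_q!=[n]_q[n-1]_q\cdots[1]_q$, $[0]_q!=1$, and ${n\brack k}_q=\frac{[n]_q!}{[k]_q![n-k]_q!}$ for $0\le k\le n$. The $q$-Fubini numbers $f_{n,q}$ are determined by $f_{0,q}=1$ and $f_{n,q}=\sum_{k=0}^{n-1}{n\brack k}_q f_{k,q}$ for $n\ge1$. $\mathfrak P_n^k$ is the set of ordered partitions $\rho=(B_1,\dots,B_k)$ of $[n]=\{1,\dots,n\}$ into $k$ nonempty blocks whose elements are in increasing order from $1$ to $n$, i.e. every element of $B_i$ is smaller than every element of $B_{i+1}$. For example, for $n=3$ these partitions (all $k$) are $(\{1\},\{2\},\{3\})$, $(\{1,2\},\{3\})$, $(\{1\},\{2,3\})$, $(\{1,2,3\})$. *)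

(* Defs.v *)
From mathcomp Require Import all_boot all_order all_algebra.
From mathcomp Require Import reals.
From mathcomp.real_closed Require Export complex.

Set Implicit Arguments.
Unset Strict Implicit.
Unset Printing Implicit Defensive.

Import GRing.Theory.
Local Open Scope ring_scope.

Section QNumbers.
Variable F : fieldType.
Implicit Types (q : F) (n k : nat) (f : nat -> F).

Definition qint q n : F := (1 - q ^+ n) / (1 - q).

Definition qfact q n : F := \prod_(1 <= i < n.+1) qint q i.

(* Only meaningful for k <= n: n - k is truncated, so for k > n the value is
   not the conventional 0. *)
Definition qbinom q n k : F := qfact q n / (qfact q k * qfact q (n - k)).

Definition is_qFubini q f : Prop :=
  f 0%N = 1 /\
  forall n, (1 <= n)%N -> f n = \sum_(0 <= k < n) qbinom q n k * f k.

Fixpoint qFubini_prefix q n : seq F :=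
  if n is m.+1 then
    let s := qFubini_prefix q m in
    rcons s (if m == 0%N then 1 else \sum_(0 <= k < m) qbinom q m k * s`_k)
  else [::].

Lemma size_qFubini_prefix q n : size (qFubini_prefix q n) = n.
Proof. by elim: n => //= n IH; rewrite size_rcons IH. Qed.

Lemma nth_qFubini_prefix q n k : (k < n)%N ->
  (qFubini_prefix q n)`_k = (qFubini_prefix q k.+1)`_k.
Proof.
elim: n => // n IH; rewrite ltnS leq_eqVlt => /orP[/eqP-> //|lt_kn].
by rewrite -(IH lt_kn) /= nth_rcons size_qFubini_prefix lt_kn.
Qed.

Lemma is_qFubini_exists q : exists f, is_qFubini q f.
Proof.
exists (fun n => (qFubini_prefix q n.+1)`_n); split=> // n n_gt0.
rewrite [in LHS]/= nth_rcons size_qFubini_prefix ltnn eqxx.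
rewrite -[n == 0%N]negbK -lt0n n_gt0 /=.
rewrite big_nat [in RHS]big_nat; apply: eq_bigr => k /andP[_ lt_kn].
by rewrite nth_qFubini_prefix.
Qed.

Lemma is_qFubini_unique q f g : is_qFubini q f -> is_qFubini q g -> f =1 g.
Proof.
move=> [f0 fE] [g0 gE]; elim/ltn_ind=> -[_|n IH]; first by rewrite f0 g0.
rewrite fE // gE // big_nat [in RHS]big_nat.
by apply: eq_bigr => k /andP[_ lt_kn]; rewrite IH.
Qed.

End QNumbers.

(* The element j of [n] = {1, ..., n} is the ordinal of value j.-1, and the
   block B_i is the entry of index i.-1 of the tuple. *)
Definition increasing_partitions (n k : nat) : {set k.-tuple {set 'I_n}} :=
  [set rho : k.-tuple {set 'I_n} |
    [&& uniq rho,
        partition [set:: rho] [set: 'I_n]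
      & sorted (fun A B : {set 'I_n} =>
                  [forall x in A, forall y in B, (x < y)%N]) rho]].

Section Blocks.
Variables n k : nat.
Implicit Type rho : k.-tuple {set 'I_n}.

(* 1-based: block_size rho i is b_i = |B_i| for 1 <= i <= k. *)
Definition block_size rho (i : nat) : nat := #|nth set0 rho i.-1|.

Definition block_sum rho (i : nat) : nat :=
  (\sum_(1 <= j < i.+1) block_size rho j)%N.

End Blocks.

(* Main.v *)
Require Import Defs.
From mathcomp Require Import all_boot all_order all_algebra.
From mathcomp Require Import reals.
From mathcomp.real_closed Require Import complex.

(** Both sides satisfy the same recursion.  In an increasing partition of [n]
    with k + 1 blocks the last block is closed upwards, hence it is
    {m + 1, ..., n} for some m < n, and the other blocks form an arbitrary
    increasing partition of [m] with k blocks.  The leading factor of the weight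
    is the q-binomial of s_(k+1) = n over b_(k+1) = n - m, which by symmetry is
    the one of n over m, and the remaining factors are the weight of the smaller
    partition.  So the weighted count S(n, k) satisfies

      S(n, k + 1) = \sum_(m < n) [n over m]_q S(m, k)

    ([weighted_count_succ]).  Summing over k, the total weight of [n] obeys the
    recursion that defines f, and strong induction concludes.
    The symmetry of the q-binomial is commutativity of the product in its
    denominator.

    To split off the last block, membership in [increasing_partitions] is
    first put in a form that is stable under removing the last entry of a
    sequence: the blocks are nonempty, they cover, and any two of them are in
    order ([mem_increasing_partitions]). *)

Set Implicit Arguments.
Unset Strict Implicit.
Unset Printing Implicit Defensive.

Import GRing.Theory.
Local Open Scope ring_scope.

(** * Increasing partitions as sequences of pairwise ordered blocks *)

Definition before n (A B : {set 'I_n}) : bool :=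
  [forall x in A, forall y in B, (x < y)%N].

Lemma beforeP n (A B : {set 'I_n}) :
  reflect {in A & B, forall x y : 'I_n, (x < y)%N} (before A B).
Proof.
apply: (iffP forall_inP) => [AB x y xA yB|AB x xA].
  exact: (forall_inP (AB x xA)).
by apply/forall_inP => y yB; apply: AB.
Qed.

Definition ordered_cover n (s : seq {set 'I_n}) : bool :=
  [&& set0 \notin s, pairwise (@before n) s
    & [forall x, has (fun A : {set 'I_n} => x \in A) s]].

(** [before] is transitive only through a nonempty middle block, which is why
    nonemptiness has to be used to pass from consecutive blocks to all pairs. *)
Lemma sorted_before_pairwise n (s : seq {set 'I_n}) :
  set0 \notin s -> sorted (@before n) s = pairwise (@before n) s.
Proof.
move=> s0; apply: (@sorted_pairwise_in _ (fun A => A != set0)); last first.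
  by apply/allP => A As; apply: contraNneq s0 => <-.
move=> B A C /set0Pn[y yB] _ _ /beforeP AB /beforeP BC.
apply/beforeP => x z xA zC; exact: ltn_trans (AB _ _ xA yB) (BC _ _ yB zC).
Qed.

Lemma pairwise_before_uniq n (s : seq {set 'I_n}) :
  set0 \notin s -> pairwise (@before n) s -> uniq s.
Proof.
move=> s0; rewrite uniq_pairwise.
apply: (@sub_in_pairwise _ (fun A => A != set0)); last first.
  by apply/allP => A As; apply: contraNneq s0 => <-.
move=> A B /set0Pn[x xA] _ /beforeP AB /=; apply/eqP => eqAB.
by have := AB x x xA; rewrite -eqAB ltnn => /(_ xA).
Qed.

Lemma before_disjoint n (A B : {set 'I_n}) : before A B -> [disjoint A & B].
Proof.
move=> /beforeP AB; rewrite -setI_eq0; apply/eqP/setP => x; rewrite !inE.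
by apply/negP => /andP[xA xB]; have := AB x x xA xB; rewrite ltnn.
Qed.

Lemma pairwise_before_trivIset n (s : seq {set 'I_n}) :
  pairwise (@before n) s -> trivIset [set:: s].
Proof.
move=> /(pairwiseP set0) lts; apply/trivIsetP => A B; rewrite !inE.
move=> /(nthP set0)[i ilt <-] /(nthP set0)[j jlt <-].
case: (ltngtP i j) => [ij _|ji _|->]; last by rewrite eqxx.
  by apply: before_disjoint; apply: lts.
by rewrite disjoint_sym; apply: before_disjoint; apply: lts.
Qed.

Lemma mem_increasing_partitions n k (rho : k.-tuple {set 'I_n}) :
  (rho \in increasing_partitions n k) = ordered_cover rho.
Proof.
rewrite inE /ordered_cover /partition inE.
have [rho0|rho0] := boolP (set0 \in rho); first by rewrite !andbF.
rewrite -/(@before n) sorted_before_pairwise //=.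
have [lts|] := boolP (pairwise _ rho); last by rewrite !andbF.
rewrite (pairwise_before_uniq rho0 lts) (pairwise_before_trivIset lts) /= !andbT.
apply/eqP/forallP => [cov x|cov].
  have: x \in cover [set:: rho] by rewrite cov.
  by case/bigcupP => A; rewrite inE => Arho xA; apply/hasP; exists A.
apply/setP => x; rewrite in_setT; have /hasP[A Arho xA] := cov x.
by apply/bigcupP; exists A; rewrite ?inE.
Qed.

Lemma sum_card_increasing_partition n k (rho : k.-tuple {set 'I_n}) :
  rho \in increasing_partitions n k -> (\sum_(A <- rho) #|A|)%N = n.
Proof.
rewrite inE => /and3P[Urho /card_partition cardE _].
rewrite -[RHS]card_ord -cardsT cardE (big_uniq _ Urho).
by apply: eq_bigl => A; rewrite inE.
Qed.

(** * Splitting off the last block *)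

Definition upper_block n m : {set 'I_n} := [set x : 'I_n | (m <= x)%N].

Lemma card_upper_block n m : (m <= n)%N -> #|upper_block n m| = (n - m)%N.
Proof.
move=> le_mn; have -> : upper_block n m = ~: [set x : 'I_n | (x < m)%N].
  by apply/setP => x; rewrite !inE -leqNgt.
rewrite cardsCs setCK card_ord; congr (_ - _)%N.
have -> : [set x : 'I_n | (x < m)%N] = widen_ord le_mn @: setT.
  apply/setP => x; rewrite inE; apply/idP/imsetP => [xm|[y _ ->]]; last first.
    exact: (ltn_ord y).
  by exists (Ordinal xm) => //; apply: val_inj.
rewrite card_imset ?cardsT ?card_ord //.
by move=> x y /(congr1 val) /= /val_inj.
Qed.

(** An element above a member of the last block lies in no earlier block, so the
    last block is closed upwards and its least element determines it. *)
Lemma last_block_upper n (s : seq {set 'I_n}) (B : {set 'I_n}) :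
  ordered_cover (rcons s B) ->
  exists2 m, (m < n)%N & B = upper_block n m.
Proof.
rewrite /ordered_cover mem_rcons inE negb_or pairwise_rcons.
move=> /and3P[/andP[B0 _] /andP[/allP sB _] /forallP cov].
have /set0Pn[y0 y0B] : B != set0 by rewrite eq_sym.
case: (arg_minnP (fun x : 'I_n => val x) y0B) => y yB ymin.
exists y => //; apply/setP => x; rewrite inE; apply/idP/idP => [/ymin //|yx].
have := cov x; rewrite has_rcons => /orP[//|/hasP[A As xA]].
by have /beforeP/(_ x y xA yB) := sB A As; rewrite ltnNge yx.
Qed.

Section Split.
Variables (n m k : nat) (lt_mn : (m < n)%N).

Let w : 'I_m -> 'I_n := widen_ord (ltnW lt_mn).

Let w_inj : injective w.
Proof. by move=> x y /(congr1 val) /= /val_inj. Qed.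

Let restrict_lift (A : {set 'I_m}) : w @^-1: (w @: A) = A.
Proof. by apply/setP => x; rewrite inE mem_imset. Qed.

Let lift_restrict (A : {set 'I_n}) :
  before A (upper_block n m) -> w @: (w @^-1: A) = A.
Proof.
move=> /beforeP Am; apply/setP => x; apply/imsetP/idP => [[y + ->]|xA].
  by rewrite inE.
(* The ordinal m is the least element of the upper block. *)
have xm : (x < m)%N by apply: (Am x (Ordinal lt_mn)); rewrite ?inE.
have xE : x = w (Ordinal xm) by apply: val_inj.
by exists (Ordinal xm) => //; rewrite inE -xE.
Qed.

Definition append_upper (t : k.-tuple {set 'I_m}) : k.+1.-tuple {set 'I_n} :=
  [tuple of rcons [seq w @: (A : {set 'I_m}) | A <- t] (upper_block n m)].

Definition drop_last (rho : k.+1.-tuple {set 'I_n}) : k.-tuple {set 'I_m} :=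
  [tuple of [seq w @^-1: (A : {set 'I_n})
            | A <- belast (thead rho) (behead rho)]].

Lemma append_upperK : cancel append_upper drop_last.
Proof.
move=> t; apply: val_inj => /=.
have -> : belast (thead (append_upper t)) (behead (append_upper t))
        = [seq w @: (A : {set 'I_m}) | A <- t].
  have := congr1 val (tuple_eta (append_upper t)); rewrite /= lastI.
  by move=> /rcons_inj[<-].
by rewrite -map_comp (eq_map (restrict_lift : _ \o _ =1 id)) map_id.
Qed.

Lemma append_upper_increasing (t : k.-tuple {set 'I_m}) :
  (append_upper t \in increasing_partitions n k.+1)
  = (t \in increasing_partitions m k).
Proof.
rewrite !mem_increasing_partitions /ordered_cover mem_rcons inE negb_or.
have -> : set0 != upper_block n m.
  rewrite eq_sym; apply/set0Pn; exists (Ordinal lt_mn).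
  by rewrite inE.
have imset0E : (w @: set0) = set0 by rewrite imset0.
rewrite -[X in X \in map _ _]imset0E (mem_map (imset_inj w_inj)) /=.
have -> : pairwise (@before n)
            (rcons [seq w @: (A : {set 'I_m}) | A <- t] (upper_block n m))
        = pairwise (@before m) t.
  rewrite pairwise_rcons (_ : all _ _ = true) /=; last first.
    rewrite all_map; apply/allP => A _ /=; apply/beforeP => _ y /imsetP[x _ ->].
    by rewrite inE; apply: leq_trans; rewrite /= ltn_ord.
  rewrite pairwise_map; apply: eq_pairwise => A B /=.
  apply/beforeP/beforeP => AB x y => [xA yB|/imsetP[a aA ->] /imsetP[b bB ->]].
    by apply: (AB (w x) (w y)); rewrite mem_imset.
  exact: (AB a b).
congr [&& _, _ & _]; apply/forallP/forallP => cov x.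
  have := cov (w x); rewrite has_rcons inE leqNgt (ltn_ord x : w x < m)%N /= has_map.
  by move/hasP=> [A At /=]; rewrite mem_imset // => xA; apply/hasP; exists A.
rewrite has_rcons inE; case: leqP => //= xm.
have /hasP[A At xA] := cov (Ordinal xm).
rewrite has_map; apply/hasP; exists A => //=; apply/imsetP.
by exists (Ordinal xm) => //; apply: val_inj.
Qed.

Lemma drop_lastK (rho : k.+1.-tuple {set 'I_n}) :
  rho \in increasing_partitions n k.+1 ->
  last set0 rho = upper_block n m -> append_upper (drop_last rho) = rho.
Proof.
rewrite mem_increasing_partitions; case/tupleP: rho => A t incl lastE.
apply: val_inj; rewrite /= theadE.
move: incl lastE; rewrite /= lastI => incl lastE.
rewrite -lastE; congr rcons; rewrite -map_comp -[RHS]map_id.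
apply/eq_in_map => B Bs /=; apply: lift_restrict; rewrite -lastE.
move: incl => /and3P[_ + _]; rewrite pairwise_rcons => /andP[/allP beforeA _]; exact: beforeA.
Qed.

End Split.

(** * Weights *)

Section Weight.
Variables (F : fieldType) (q : F).

Definition weight n k (rho : k.-tuple {set 'I_n}) : F :=
  \prod_(0 <= i < k) qbinom q (block_sum rho (k - i)) (block_size rho (k - i)).

Definition weighted_count n k : F :=
  \sum_(rho in increasing_partitions n k) weight rho.

Lemma qbinom_sym n m : (m <= n)%N -> qbinom q n (n - m) = qbinom q n m.
Proof. by move=> le_mn; rewrite /qbinom subKn // [X in _ / X]mulrC. Qed.

Lemma block_sum_size n k (rho : k.-tuple {set 'I_n}) :
  block_sum rho k = (\sum_(A <- rho) #|A|)%N.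
Proof.
by rewrite /block_sum big_add1 /= (big_nth set0) size_tuple.
Qed.

Lemma block_size_append n m k (lt_mn : (m < n)%N) (t : k.-tuple {set 'I_m}) i :
  (0 < i <= k)%N -> block_size (append_upper lt_mn t) i = block_size t i.
Proof.
case: i => //= i; rewrite /block_size /= => lt_ik.
rewrite nth_rcons size_map size_tuple lt_ik (nth_map set0) ?size_tuple //.
by rewrite card_imset // => x y /(congr1 val) /= /val_inj.
Qed.

Lemma block_sum_append n m k (lt_mn : (m < n)%N) (t : k.-tuple {set 'I_m}) i :
  (i <= k)%N -> block_sum (append_upper lt_mn t) i = block_sum t i.
Proof.
move=> le_ik; rewrite /block_sum; apply: eq_big_nat => j /andP[j0 ji].
by rewrite block_size_append // j0 (leq_trans _ le_ik).
Qed.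

Lemma weight_append n m k (lt_mn : (m < n)%N) (t : k.-tuple {set 'I_m}) :
  t \in increasing_partitions m k ->
  weight (append_upper lt_mn t) = qbinom q n m * weight t.
Proof.
move=> tinc; rewrite /weight big_nat_recl // subn0; congr (_ * _).
  rewrite block_sum_size (sum_card_increasing_partition (n := n)); last first.
    by rewrite append_upper_increasing.
  rewrite /block_size /= nth_rcons size_map size_tuple ltnn eqxx.
  by rewrite card_upper_block ?qbinom_sym // ltnW.
apply: eq_big_nat => i /andP[_ lt_ik]; rewrite subSS.
by rewrite block_sum_append ?block_size_append ?leq_subr // subn_gt0 lt_ik.
Qed.

Lemma weighted_count_succ n k :
  weighted_count n k.+1 = \sum_(0 <= m < n) qbinom q n m * weighted_count m k.
Proof.
rewrite big_mkord /weighted_count.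
have last_upper (rho : k.+1.-tuple {set 'I_n}) :
    rho \in increasing_partitions n k.+1 ->
    exists2 m, (m < n)%N & last set0 rho = upper_block n m.
  rewrite mem_increasing_partitions; case/tupleP: rho => A t /=.
  by rewrite lastI; apply: last_block_upper.
have upper_inj : {in gtn n &, injective (upper_block n)}.
  move=> a b an bn /(congr1 (fun A : {set _} => #|A|)).
  rewrite !card_upper_block ?(ltnW an) ?(ltnW bn) // => eq_ab.
  by rewrite -(subKn (ltnW an)) eq_ab subKn // ltnW.
transitivity (\sum_(rho in increasing_partitions n k.+1)
    \sum_(m < n | last set0 rho == upper_block n m) weight rho).
  apply: eq_bigr => rho /last_upper[m lt_mn ->].
  rewrite (big_pred1 (Ordinal lt_mn)) // => a /=.
  by rewrite (inj_in_eq upper_inj) ?inE // eq_sym.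
rewrite (exchange_big_dep predT) //=; apply: eq_bigr => m _.
rewrite (reindex_onto (@append_upper n m k (ltn_ord m)) (drop_last (ltn_ord m))).
  rewrite mulr_sumr; apply: eq_big => [t|t].
    rewrite append_upperK eqxx append_upper_increasing /= last_rcons eqxx.
    by rewrite !andbT.
  by rewrite append_upper_increasing => /andP[/andP[tinc _] _]; apply: weight_append.
by move=> rho /andP[inc /eqP]; apply: drop_lastK.
Qed.

Lemma weighted_count0 n : weighted_count n 0 = (n == 0%N)%:R.
Proof.
rewrite /weighted_count; case: n => [|n].
  rewrite (big_pred1 [tuple]) => [|rho]; first by rewrite /weight big_nil.
  rewrite mem_increasing_partitions (tuple0 rho) /= eqxx.
  by apply/and3P; split=> //; apply/forallP => -[].
rewrite big_pred0 // => rho; rewrite mem_increasing_partitions (tuple0 rho).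
by apply/and3P => -[_ _ /forallP/(_ ord0)].
Qed.

Lemma weighted_count_small n k : (n < k)%N -> weighted_count n k = 0.
Proof.
elim: k n => // k IH n; rewrite ltnS => le_nk; rewrite weighted_count_succ.
apply: big1_seq => m; rewrite mem_index_iota => /andP[_ /andP[_ lt_mn]].
by rewrite IH ?mulr0 // (leq_trans lt_mn).
Qed.

(** The index k starts at 0 here, so that the statement also holds for n = 0 and
    the induction is uniform. *)
Lemma qFubini_weighted_count (f : nat -> F) n :
  is_qFubini q f -> f n = \sum_(0 <= k < n.+1) weighted_count n k.
Proof.
move=> [f0 fE]; elim/ltn_ind: n => -[_|n IH].
  by rewrite big_nat1 weighted_count0.
rewrite fE // [RHS]big_nat_recl // weighted_count0 add0r.
under [RHS]eq_bigr do rewrite weighted_count_succ.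
rewrite exchange_big_nat /=; apply: eq_big_nat => m /andP[_ lt_mn].
rewrite -mulr_sumr IH //; congr (_ * _).
rewrite [RHS](big_cat_nat (leq0n m.+1) lt_mn) //= [X in _ = _ + X]big1_seq ?addr0 // => k.
by rewrite mem_index_iota => /andP[_ /andP[lt_mk _]]; apply: weighted_count_small.
Qed.

End Weight.

Unset Implicit Arguments.
Local Open Scope complex_scope.

Theorem proposition4p3 (R : realType) (q : R[i]) (f : nat -> R[i])
    (q_neq0 : q != 0)
    (q_nroot : forall m : nat, (0 < m)%N -> ~~ m.-unity_root q)
    (f_qFubini : is_qFubini q f) :
  f 0%N = 1 /\
  forall n : nat, (1 <= n)%N ->
    f n = \sum_(1 <= k < n.+1)
            \sum_(rho in increasing_partitions n k)
              \prod_(0 <= i < k)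
                qbinom q (block_sum rho (k - i)) (block_size rho (k - i)).
Proof.
split=> [|n n_gt0]; first by case: f_qFubini.
rewrite (qFubini_weighted_count n f_qFubini) big_ltn // weighted_count0.
by rewrite eqn0Ngt n_gt0 add0r.
Qed.
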